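(* Fix any constants $0 < \epsilon,\beta < 1/8$, and let $\delta(n) \le 1/(200 n^2)$. Let $X\subseteq\mathbb{R}$ be finite and totally ordered, and let $\Delta,t,w$ be such that $\Delta<t\leq n$ and $w\leq \frac{1}{4}\mathrm{tower}(\log(n^{1/5}/40))$. For every $(\epsilon,\delta(n))$-differentially private algorithm that solves the 1-cluster problem $(X,n,t)$ with parameters $(\Delta,w)$ and error probability $\beta$, it holds that $n\geq\Omega(\log^*|X|)$.
   Context: Differential privacy: two databases $S,S'\in U^n$ are neighboring if they differ on at most one row. A randomized algorithm $M:U^n\to Y$ is $(\epsilon,\delta)$-differentially private if for all neighboring $S,S'\in U^n$ and every $T\subseteq Y$, $\Pr[M(S)\in T]\le e^{\epsilon}\Pr[M(S')\in T]+\delta$. 1-cluster problem (dimension $1$): an algorithm $\mathcal M$ solves $(X,n,t)$ (with $n\ge t$) with parameters $(\Delta,w)$ and error probability $\beta$ if for every $S\in X^n$, $\mathcal M(S)$ outputs a center $c$ and a radius $r$ such that with probability at least $1-\beta$: (1) the ball (interval) of radius $r$ around $c$ contains at least $t-\Delta$ input points from $S$ (with multiplicity); (2) $r\le w\cdot r_{opt}$, where $r_{opt}$ is the radius of the smallest ball in $X$ containing at least $t$ input points. Iterated exponentials: $\mathrm{tower}(0)=1$ and $\mathrm{tower}(j)=2^{\mathrm{tower}(j-1)}$. $\log^*$ is the iterated logarithm. *)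

(* Defs.v *)
From mathcomp Require Import all_boot all_order all_algebra finmap.
From mathcomp Require Import all_classical all_reals all_analysis.

Set Implicit Arguments.
Unset Strict Implicit.
Unset Printing Implicit Defensive.

Import Order.TTheory GRing.Theory Num.Theory.
Local Open Scope ring_scope.

(* At a real argument [x], [tower] is used as [tower (Num.truncn x)]: for
   [0 <= x], [y <= (tower (Num.truncn x))%:R] means that the iterated
   logarithm of [y] is at most [x]; for [x < 0], the value is [tower 0]. *)
Definition tower (j : nat) : nat := iter j (expn 2) 1%N.

Definition log2 (R : realType) (x : R) : R := ln x / ln 2.

Lemma logstar_ex (R : realType) (x : R) :
  exists k, iter k (@log2 R) x <= 1.
Proof.
have ln2_gt0 : 0 < ln 2 :> R by rewrite ln_gt0// ltr1n.
suff H m (y : R) : y <= m.+1%:R -> iter m (@log2 R) y <= 1.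
  by exists (Num.truncn x); apply: H; rewrite ltW// truncnS_gt.
elim: m y => [//|m IHm] y ym; rewrite iterSr; apply: IHm.
rewrite /log2 ler_pdivrMr//.
have [y0|y0] := leP y 0.
  by rewrite ln0// mulr_ge0// ltW.
have -> : m.+1%:R * ln 2 = ln (2 ^+ m.+1) :> R by rewrite lnXn// mulr_natl.
rewrite ler_ln ?posrE ?exprn_gt0//.
by rewrite (le_trans ym)// -natrX ler_nat ltn_expl.
Qed.

(* [logstar x = 0] if [x <= 1], and [logstar (tower j)%:R = j]. *)
Definition logstar (R : realType) (x : R) : nat := ex_minn (logstar_ex x).

Definition neighboring (U : eqType) (n : nat) (S S' : n.-tuple U) : Prop :=
  (#|[pred i : 'I_n | tnth S i != tnth S' i]| <= 1)%N.

(* A randomized algorithm is given by the law [M S] of its output on each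
   input [S]; events are the measurable subsets of the output space. *)
Definition differentially_private (R : realType) (eps delta : R)
    (U : eqType) (n : nat) (d : measure_display) (Y : measurableType d)
    (M : n.-tuple U -> probability Y R) : Prop :=
  forall S S' : n.-tuple U, neighboring S S' ->
  forall T : set Y, measurable T ->
  (M S T <= (expR eps)%:E * M S' T + delta%:E)%E.

Definition ball_count (R : realType) (X : {fset R}) (n : nat)
    (S : n.-tuple X) (c r : R) : nat :=
  #|[pred i : 'I_n | `|val (tnth S i) - c| <= r]|.

(* Balls in [X] are centered at points of [X]. *)
Definition r_opt (R : realType) (X : {fset R}) (n t : nat)
    (S : n.-tuple X) : R :=
  inf [set r : R | 0 <= r /\
                   exists c : X, (t <= ball_count S (val c) r)%N]%classic.

(* The output is the pair (center, radius); the center need not be in [X]. *)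
Definition solves_1cluster (R : realType) (X : {fset R}) (n t : nat)
    (Delta w beta : R)
    (M : n.-tuple X ->
         probability (measurableTypeR R * measurableTypeR R)%type R) : Prop :=
  forall S : n.-tuple X,
  ((1 - beta)%:E <=
   M S [set cr : R * R |
                 (t%:R - Delta <= (ball_count S cr.1 cr.2)%:R)%R /\
                 (cr.2 <= w * r_opt t S)%R]%classic)%E.

(* Main.v *)
Require Import Defs.
From mathcomp Require Import all_boot all_order all_algebra finmap.
From mathcomp Require Import all_classical all_reals all_analysis.
From mathcomp Require Import measurable_realfun zify ring lra.

(** If an interval [c - r, c + r] contains an input point and
    [r <= W / 4 * (max - min)], then one of [W + 1] equally spaced points of the
    interval lies in [min, max].  A private 1-cluster algorithm is thus a private
    algorithm which outputs [L = W + 1] points, one of them between the smallest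
    and the largest row (the interior point problem with list output).  For that
    problem the induction of Bun, Nissim, Stemmer and Vadhan works: from
    [k + 1] rows in [0, b ^ s) one gets [k] rows in [0, s), by hiding a uniform
    [y] with [s] digits in base [b], replacing each row [i] by [y] truncated to
    its first [i] digits, and answering with the number of leading digits on
    which each candidate agrees with [y].  By privacy the next digit after the
    largest row cannot be guessed with probability much above [L / b], so every
    step costs one exponential in the domain and [e * L / b + delta] in the
    success probability.  With [b] of order [n * L] the total loss stays small, so
    the domain of the [n]-row problem is at most a tower of height [O(n)]. *)

Set Implicit Arguments.
Unset Strict Implicit.
Unset Printing Implicit Defensive.

Import Order.TTheory GRing.Theory Num.Theory.
Local Open Scope ring_scope.

(** * Interior points with list output *)

(** A number below [b ^ s] is read as a word of [s] base-[b] digits, leading digit first; the last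
    [s - m] digits are set to 0. *)
Definition trunc_digits (b s y m : nat) : nat :=
  (y %/ b ^ (s - m) * b ^ (s - m))%N.

Definition agree (b s y a j : nat) : bool :=
  (a %/ b ^ (s - j) == y %/ b ^ (s - j))%N.

(** A candidate [a >= b ^ s] agrees with [y < b ^ s] for no [j], not even for 0; the empty maximum
    then gives 0. *)
Definition agreement (b s y a : nat) : nat :=
  (\max_(j < s.+1 | agree b s y a j) j)%N.

Definition encode (b s y : nat) (x : seq nat) : seq nat :=
  y :: map (trunc_digits b s y) x.

Definition hits (x l : seq nat) : bool :=
  has (fun a => has (leq^~ a) x && has (leq a) x) l.

Lemma divn_expn_le (b s y i j : nat) : (i <= j <= s)%N ->
  (y %/ b ^ (s - i) = y %/ b ^ (s - j) %/ b ^ (j - i))%N.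
Proof. by move=> ijs; rewrite -divnMA -expnD; congr (_ %/ b ^ _)%N; lia. Qed.

Lemma agree_le (b s y a i j : nat) : (i <= j <= s)%N ->
  agree b s y a j -> agree b s y a i.
Proof.
by move=> ijs /eqP aj; rewrite /agree !(divn_expn_le _ _ ijs) aj.
Qed.

Lemma leq_agreement (b s y a j : nat) : (j <= s)%N ->
  agree b s y a j -> (j <= agreement b s y a)%N.
Proof.
by move=> js aj; rewrite (leq_bigmax_cond (Ordinal (js : (j < s.+1)%N))).
Qed.

Lemma ltn_agreement (b s y a m : nat) : (m < agreement b s y a)%N ->
  (m < s)%N /\ agree b s y a m.+1.
Proof.
have [//|[i ai lei]] : agreement b s y a = 0%N \/
    exists2 i : 'I_s.+1, agree b s y a i & (agreement b s y a <= i)%N.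
  rewrite /agreement; elim/big_ind: _ => [||i ai]; [by left| |by right; exists i].
  move=> u v [->|[i ai ui]] [->|[j aj vj]]; rewrite ?max0n ?maxn0.
  - by left.
  - by right; exists j.
  - by right; exists i.
  - right; case: (leqP u v) => uv; first by exists j => //; lia.
    by exists i => //; lia.
- by move=> ->.
- move=> mlt; have ? := ltn_ord i; split; first by lia.
  by apply: agree_le ai; lia.
Qed.

Lemma trunc_digits_le (b s y m : nat) : (trunc_digits b s y m <= y)%N.
Proof. exact: leq_divM. Qed.

Lemma trunc_digits_div (b s y i j : nat) : (0 < b)%N -> (i <= j <= s)%N ->
  (trunc_digits b s y j %/ b ^ (s - i) = y %/ b ^ (s - i))%N.
Proof.
by move=> b0 ijs; rewrite !(divn_expn_le _ _ ijs) mulnK// expn_gt0 b0.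
Qed.

Lemma trunc_digitsK (b s y i j : nat) : (0 < b)%N -> (i <= j <= s)%N ->
  trunc_digits b s (trunc_digits b s y j) i = trunc_digits b s y i.
Proof. by move=> b0 ijs; rewrite {1}/trunc_digits trunc_digits_div. Qed.

Lemma seq_min (x : seq nat) : x != [::] -> exists2 i, i \in x & all (leq i) x.
Proof.
elim: x => // a [_ _|c x IH _]; first by exists a; rewrite ?mem_head//= leqnn.
have [//|i ix /allP lei] := IH.
have [ai|ia] := leqP a i.
  exists a; first exact: mem_head.
  apply/allP => j; rewrite inE => /predU1P[->//|/lei]; exact: leq_trans.
exists i; first by rewrite inE ix orbT.
by apply/allP => j; rewrite inE => /predU1P[->|/lei//]; exact: ltnW.
Qed.

Lemma seq_max (x : seq nat) : x != [::] -> (\max_(i <- x) i)%N \in x.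
Proof.
elim: x => // a [_ _|c x /(_ isT) IH _]; first by rewrite big_seq1 mem_head.
rewrite big_cons inE; case: leqP => _; last by rewrite eqxx.
by rewrite IH orbT.
Qed.

(** All rows of the encoding share with [y] the first min [x] digits, hence so does any [a] between
    two of them. If its agreement is at most max [x], it lies between rows of [x]; otherwise [a]
    gives away one more digit of [y] than the largest row does. *)
Lemma hits_encode (b s y : nat) (x l : seq nat) : (0 < b)%N ->
  all (fun i => i < s)%N x -> x != [::] -> hits (encode b s y x) l ->
  hits x (map (agreement b s y) l) ||
  has (fun a => agree b s y a (\max_(i <- x) i).+1) l.
Proof.
move=> b0 /allP xs x0 /hasP[a al /andP[/hasP[u uE ua] /hasP[v vE av]]].
have [M_lt|le_M] := ltnP (\max_(i <- x) i)%N (agreement b s y a).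
  by apply/orP; right; apply/hasP; exists a => //; case: (ltn_agreement M_lt).
apply/orP; left; apply/hasP; exists (agreement b s y a); first exact: map_f.
apply/andP; split; last by apply/hasP; exists (\max_(i <- x) i)%N => //; exact: seq_max.
have [mu mux /allP lemu] := seq_min x0.
have mus := xs _ mux.
have muE w : w \in encode b s y x -> (w %/ b ^ (s - mu) = y %/ b ^ (s - mu))%N.
  rewrite inE => /predU1P[->//|/mapP[i ix ->]]; rewrite trunc_digits_div//.
  by rewrite lemu//= ltnW// xs.
apply/hasP; exists mu => //; apply: leq_agreement; first exact: ltnW.
by rewrite /agree eqn_leq -{1}(muE v)// -(muE u)// !leq_div2r.
Qed.

Lemma card_divn_eq (N B c : nat) : (0 < B)%N ->
  (#|[pred y : 'I_N | y %/ B == c]| <= B)%N.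
Proof.
move=> B0; rewrite -[X in (_ <= X)%N]card_ord.
apply: (@leq_card_in _ _ (fun y : 'I_N => Ordinal (ltn_pmod y B0))) => y z.
rewrite !inE => /eqP yc /eqP zc [yz]; apply: val_inj => /=.
by rewrite (divn_eq y B) (divn_eq z B) yc zc yz.
Qed.

(** * Private mechanisms with list output *)

Definition rows (k s : nat) (x : seq nat) : bool :=
  (size x == k) && all (fun i => i < s)%N x.

(** [e] plays the part of exp(eps), [gamma] that of the success probability. Privacy concerns the
    whole outcome [o], of which the list [f o] is a function; the outcome may therefore carry more
    than the list. *)
Record list_interior_point (R : realFieldType) (e delta gamma : R)
    (L k s : nat) (Omega : finType) (p : seq nat -> Omega -> R)
    (f : Omega -> seq nat) : Prop := {
  lip_ge0 : forall x o, rows k s x -> 0 <= p x o;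
  lip_sum : forall x, rows k s x -> \sum_o p x o = 1;
  lip_size : forall o, (size (f o) <= L)%N;
  lip_private : forall x1 x2 u v,
    rows k s (x1 ++ u :: x2) -> rows k s (x1 ++ v :: x2) ->
    forall T : pred Omega,
    \sum_(o | T o) p (x1 ++ u :: x2) o <=
      e * (\sum_(o | T o) p (x1 ++ v :: x2) o) + delta;
  lip_hits : forall x, rows k s x -> gamma <= \sum_(o | hits x (f o)) p x o }.

Definition list_ipp (R : realFieldType) (e delta gamma : R) (L k s : nat) : Prop :=
  exists (Omega : finType) (p : seq nat -> Omega -> R) (f : Omega -> seq nat),
    list_interior_point e delta gamma L k s p f.

Lemma ler_sumU (R : realFieldType) (I : finType) (P Q S : pred I) (F : I -> R) :
  (forall i, 0 <= F i) -> (forall i, P i -> Q i || S i) ->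
  \sum_(i | P i) F i <= \sum_(i | Q i) F i + \sum_(i | S i) F i.
Proof.
move=> F0 PQS; rewrite big_mkcond [X in _ <= X + _]big_mkcond.
rewrite [X in _ <= _ + X]big_mkcond -big_split; apply: ler_sum => i _ /=.
have F0i := F0 i; have [/PQS|_] := boolP (P i).
  by case: (Q i) (S i) => [] [] //= _; lra.
by case: (Q i) (S i) => [] [] /=; lra.
Qed.

(** With a single row [z], a hit means that [z] itself is listed. Privacy compares this with the
    database of the single row 0, where a list of at most [L] entries contains a uniform [z < s]
    with probability at most [L / s]. *)
Lemma list_ipp1 (R : realFieldType) (e delta gamma : R) (L s : nat) :
  0 <= e -> (0 < s)%N -> list_ipp e delta gamma L 1 s ->
  gamma <= e * L%:R / s%:R + delta.
Proof.
move=> e0 s0 [ Omega [p [f [p0 p1 fL pdp pg]]]].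
have rz (z : 'I_s) : rows 1 s [:: val z] by rewrite /rows/= andbT.
have r0 : rows 1 s [:: 0%N] by rewrite /rows/= s0.
have H (z : 'I_s) : gamma <= e * (\sum_(o | val z \in f o) p [:: 0%N] o) + delta.
  apply: le_trans (pg _ (rz z)) _.
  have := pdp [::] [::] (val z) 0%N (rz z) r0 (fun o => val z \in f o).
  apply: le_trans; rewrite le_eqVlt; apply/orP; left; apply/eqP.
  apply: eq_bigl => o /=; rewrite /hits; apply/hasP/idP => /=.
    by move=> [a ao]; rewrite !orbF -eqn_leq => /eqP->.
  by move=> zo; exists (val z) => //; rewrite !leqnn.
have : \sum_(z < s) gamma <=
    \sum_(z < s) (e * (\sum_(o | val z \in f o) p [:: 0%N] o) + delta).
  by apply: ler_sum => z _; exact: H.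
rewrite big_split/= !sumr_const !card_ord -mulr_sumr => Hs.
have K : \sum_(z < s) \sum_(o | val z \in f o) p [:: 0%N] o <= L%:R.
  rewrite (exchange_big_dep predT)//=.
  rewrite [leRHS](_ : _ = \sum_o L%:R * p [:: 0%N] o); last first.
    by rewrite -mulr_sumr p1// mulr1.
  apply: ler_sum => o _; rewrite sumr_const -[leLHS]mulr_natl ler_wpM2r ?p0//.
  rewrite ler_nat (leq_trans _ (fL o))//.
  rewrite cardE -(size_map val); apply: uniq_leq_size.
    by rewrite map_inj_uniq ?enum_uniq//; exact: val_inj.
  by move=> _ /mapP[z + ->]; rewrite mem_enum.
rewrite -lerBlDr ler_pdivlMr ?ltr0n// mulrBl !(mulr_natr _ s) lerBlDr.
by apply: le_trans Hs _; rewrite lerD2r ler_wpM2l.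
Qed.

Lemma rows_encode (b s k y : nat) (x : seq nat) : (y < b ^ s)%N ->
  rows k s x -> rows k.+1 (b ^ s) (encode b s y x).
Proof.
move=> ys /andP[/eqP <- _]; rewrite /rows /= size_map eqxx ys/=.
apply/allP => _ /mapP[i _ ->]; exact: leq_ltn_trans (trunc_digits_le _ _ _ _) ys.
Qed.

(** * Guessing the next digit *)

Section digit_guessing.
Context (R : realFieldType) (e delta gamma : R) (L k s b : nat).
Context (Omega : finType) (p : seq nat -> Omega -> R) (f : Omega -> seq nat).
Hypothesis e0 : 0 <= e.
Hypothesis b0 : (0 < b)%N.
Hypothesis pf : list_interior_point e delta gamma L k.+1 (b ^ s) p f.

Let guess (y m : nat) (o : Omega) := has (fun a => agree b s y a m.+1) (f o).

(** Each listed [a] prescribes [m + 1] digits of [y] and leaves at most [b ^ (s - m - 1)]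
    choices. *)
Lemma card_guess (m q : nat) (o : Omega) : (m < s)%N ->
  (#|[pred y : 'I_(b ^ s) | guess y m o && (y %/ b ^ (s - m) == q)]|
    <= L * b ^ (s - m.+1))%N.
Proof.
move=> ms; apply: leq_trans (_ : size (f o) * b ^ (s - m.+1) <= _)%N; last first.
  by rewrite leq_mul2r (lip_size pf) orbT.
apply: (@leq_trans #|[pred y : 'I_(b ^ s) | guess y m o]|).
  by apply: subset_leq_card; apply/fintype.subsetP => y; rewrite !inE => /andP[].
rewrite /guess; elim: (f o) => [|a l IH]; first by rewrite eq_card0.
rewrite mulSn; apply: leq_trans (leq_add (card_divn_eq (b ^ s)
  (a %/ b ^ (s - m.+1)) _) IH); last by rewrite expn_gt0 b0.
rewrite -cardUI; apply: leq_trans (leq_addr _ _).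
apply: subset_leq_card; apply/fintype.subsetP => y; rewrite !inE /=.
by rewrite /agree eq_sym.
Qed.

(* The rows of [encode (trunc_digits b s y m) x] depend only on the first [m]
   digits of [y], so digit [m.+1] is uniform given the output. *)
Lemma guess_next_digit (x : seq nat) (m : nat) : (m < s)%N -> rows k s x ->
  \sum_(y < b ^ s) \sum_(o | guess y m o)
     p (encode b s (trunc_digits b s y m) x) o <=
  L%:R * (b ^ (s - 1))%:R.
Proof.
move=> ms rx.
have bm0 : (0 < b ^ (s - m))%N by rewrite expn_gt0 b0.
have bE : (b ^ s = b ^ m * b ^ (s - m))%N by rewrite -expnD subnKC// ltnW.
have qlt (y : 'I_(b ^ s)) : (y %/ b ^ (s - m) < b ^ m)%N.
  by rewrite ltn_divLR// -bE.
pose c (q : nat) := encode b s (q * b ^ (s - m)) x.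
have rc (q : 'I_(b ^ m)) : rows k.+1 (b ^ s) (c q).
  by apply: rows_encode => //; rewrite bE ltn_pmul2r.
(* Group the [y] by their first [m] digits [q]: within a group the input is the fixed database
   [c q], so for each outcome it remains to count the [y]. *)
rewrite (partition_big (fun y => Ordinal (qlt y)) predT)//=.
apply: (@le_trans _ _ (\sum_(q < b ^ m) (L * b ^ (s - m.+1))%:R)); last first.
  rewrite sumr_const card_ord -mulrnA -natrM ler_nat -mulnA -expnD.
  by rewrite leq_mul2l leq_pexp2l ?orbT//; lia.
apply: ler_sum => q _.
rewrite (eq_bigr (fun y : 'I_(b ^ s) => \sum_(o | guess y m o) p (c q) o)).
  rewrite (exchange_big_dep predT)//=.
  rewrite [leRHS](_ : _ = \sum_o (L * b ^ (s - m.+1))%:R * p (c q) o); last first.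
    by rewrite -mulr_sumr (lip_sum pf)// mulr1.
  apply: ler_sum => o _; rewrite sumr_const -[leLHS]mulr_natl.
  rewrite ler_wpM2r ?(lip_ge0 pf)// ler_nat (leq_trans _ (card_guess q o ms))//.
  apply: subset_leq_card; apply/fintype.subsetP => y; rewrite !inE.
  by move=> /andP[/eqP<- ->]/=.
by move=> y /eqP <-.
Qed.

(** This averages [hits_encode] over [y]. In the bad case a digit is guessed; privacy moves this
    event to a database that does not contain the digit, where [guess_next_digit] applies. *)
Lemma encode_hits_loss (x : seq nat) : (0 < k)%N -> rows k s x ->
  gamma - (e * L%:R / b%:R + delta) <=
  (\sum_(y < b ^ s) \sum_(o | hits x (map (agreement b s y) (f o)))
     p (encode b s y x) o) / (b ^ s)%:R.
Proof.
move=> k0 rx.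
have [/eqP sx /allP xs] := andP rx.
have x0 : x != [::] by rewrite -size_eq0 sx -lt0n.
set m := (\max_(i <- x) i)%N.
have ms : (m < s)%N by apply: xs; exact: seq_max.
have bs0 : (0 < b ^ s)%N by rewrite expn_gt0 b0.
(* No row of [x] exceeds [m], so truncating [y] to [m] digits changes only the first row of the
   encoding, and one use of privacy is enough. *)
have encE y : encode b s (trunc_digits b s y m) x =
    trunc_digits b s y m :: map (trunc_digits b s y) x.
  congr cons; apply/eq_in_map => i ix; rewrite trunc_digitsK//.
  by rewrite (@leq_bigmax_seq _ x predT id)//= ltnW.
have lower (y : 'I_(b ^ s)) : gamma <=
    \sum_(o | hits x (map (agreement b s y) (f o))) p (encode b s y x) o +
    (e * \sum_(o | guess y m o) p (encode b s (trunc_digits b s y m) x) o + delta).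
  have ry := rows_encode (ltn_ord y) rx.
  have rty : rows k.+1 (b ^ s) (encode b s (trunc_digits b s y m) x).
    by rewrite rows_encode// (leq_ltn_trans (trunc_digits_le _ _ _ _)).
  apply: le_trans (lip_hits pf ry) _.
  have /= dp := @lip_private _ _ _ _ _ _ _ _ _ _ pf [::]
    (map (trunc_digits b s y) x) y (trunc_digits b s y m).
  rewrite encE in rty *; apply: le_trans (lerD (lexx _) (dp ry rty (guess y m))).
  apply: ler_sumU => o; first exact: (lip_ge0 pf o ry).
  apply: hits_encode => //; exact/allP.
have := ler_sum (index_enum _) (fun y (_ : predT y) => lower y).
rewrite !big_split/= !sumr_const card_ord -mulr_sumr => Hs.
have {}Hs := le_trans Hs (lerD (lexx _) (lerD (ler_wpM2l e0
  (guess_next_digit ms rx)) (lexx _))).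
have -> : e * L%:R / b%:R = e * (L%:R * (b ^ (s - 1))%:R) / (b ^ s)%:R.
  have -> : (b ^ s = b * b ^ (s - 1))%N by rewrite -expnS; congr (_ ^ _)%N; lia.
  have h1 : (b ^ (s - 1))%:R != 0 :> R by rewrite pnatr_eq0 -lt0n expn_gt0 b0.
  have h2 : b%:R != 0 :> R by rewrite pnatr_eq0 -lt0n.
  by rewrite natrM; field; rewrite h1 h2.
rewrite ler_pdivlMr ?ltr0n// mulrBl mulrDl mulfVK ?pnatr_eq0 -?lt0n//.
by rewrite !(mulr_natr _ (b ^ s)%N) lerBlDr.
Qed.

End digit_guessing.

Lemma list_ippS (R : realFieldType) (e delta gamma : R) (L k s b : nat) :
  0 <= e -> (0 < b)%N -> (0 < k)%N ->
  list_ipp e delta gamma L k.+1 (b ^ s) ->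
  list_ipp e delta (gamma - (e * L%:R / b%:R + delta)) L k s.
Proof.
move=> e0 b0 k0 [ Omega [p [f pf]]].
have bs0 : (0 < b ^ s)%N by rewrite expn_gt0 b0.
have bsR : 0 < (b ^ s)%:R :> R by rewrite ltr0n.
(* The answers are computed from [y], so [y] joins the outcome. Its law is uniform for every [x], so
   the privacy bounds for fixed [y] can be averaged. *)
exists ('I_(b ^ s) * Omega)%type.
exists (fun x (yo : 'I_(b ^ s) * Omega) => p (encode b s yo.1 x) yo.2 / (b ^ s)%:R).
exists (fun yo : 'I_(b ^ s) * Omega => map (agreement b s yo.1) (f yo.2)).
have sumE (x : seq nat) (T : pred ('I_(b ^ s) * Omega)) :
    \sum_(yo | T yo) p (encode b s yo.1 x) yo.2 / (b ^ s)%:R =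
    (\sum_(y < b ^ s) \sum_(o | T (y, o)) p (encode b s y x) o) / (b ^ s)%:R.
  rewrite -mulr_suml (pair_big_dep predT (fun y o => T (y, o)))/=.
  by congr (_ / _); apply: eq_bigl => -[].
split=> [x [y o] rx|x rx|[y o]|x1 x2 u v rx|x rx] /=.
- by rewrite divr_ge0 ?(ltW bsR)// (lip_ge0 pf)// rows_encode.
- rewrite sumE (eq_bigr (fun=> 1)) => [|y _].
    by rewrite sumr_const card_ord divff// gt_eqF.
  by rewrite (lip_sum pf)// rows_encode.
- by rewrite size_map (lip_size pf).
- move=> rx' T; rewrite !sumE mulrA.
  rewrite [X in _ + X](_ : _ = (\sum_(y < b ^ s) delta) / (b ^ s)%:R); last first.
    by rewrite sumr_const card_ord -[_ *+ _]mulr_natr mulfK// gt_eqF.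
  rewrite -mulrDl ler_pM2r ?invr_gt0// mulr_sumr -big_split.
  apply: ler_sum => y _ /=.
  (* Changing one row of [x] changes only one row of the encoding. *)
  have := rows_encode (ltn_ord y) rx; have := rows_encode (ltn_ord y) rx'.
  by rewrite /encode !map_cat /= -!cat_cons => ry' ry; exact: (lip_private pf).
- by rewrite sumE; exact: (encode_hits_loss e0 b0 pf).
Qed.

Lemma list_ipp_iter (R : realFieldType) (e delta gamma : R) (L k s b : nat) :
  0 <= e -> (0 < b)%N -> (0 < s)%N ->
  list_ipp e delta gamma L k.+1 (iter k (expn b) s) ->
  gamma <= e * L%:R / s%:R + delta + k%:R * (e * L%:R / b%:R + delta).
Proof.
move=> e0 b0 s0; elim: k gamma => [gamma|k IH gamma].
  by rewrite mul0r addr0; exact: list_ipp1.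
move=> /(list_ippS e0 b0 (ltn0Sn k)) /IH.
by rewrite -[k.+1]addn1 natrD mulrDl mul1r; lra.
Qed.

(** * Towers and iterated logarithms *)

Lemma towerS (j : nat) : tower j.+1 = (2 ^ tower j)%N.
Proof. by []. Qed.

Lemma ltn_tower (j : nat) : (j < tower j)%N.
Proof. by elim: j => // j IH; rewrite towerS (leq_trans _ (ltn_expl _ _)). Qed.

Lemma leq_tower (i j : nat) : (i <= j)%N -> (tower i <= tower j)%N.
Proof.
move=> ij; rewrite -(subnK ij); elim: (j - i)%N => // k IH.
by rewrite addSn towerS (leq_trans IH)// ltnW// ltn_expl.
Qed.

(* The additive slack [b] in the hypothesis makes the bound stable under
   [expn b]. *)
Lemma iter_expn_tower (b s k m : nat) : (0 < b)%N ->
  (b * s + b <= tower m)%N -> (iter k (expn b) s <= tower (k + m))%N.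
Proof.
move=> b0 H; have : (b * iter k (expn b) s + b <= tower (k + m))%N.
  elim: k => // k IH; rewrite addSn towerS iterS.
  set x := iter k _ _ in IH *.
  (* The chain is [2 ^ (b * x + b) >= b ^ x * (2 * b) >= b * b ^ x + b]. *)
  apply: leq_trans (leq_pexp2l _ IH) => //.
  have bx : (b ^ x <= 2 ^ (b * x))%N.
    by rewrite expnM; case: (x) => // x'; rewrite leq_exp2r// ltnW// ltn_expl.
  rewrite expnD; have b2 : (2 * b <= 2 ^ b)%N.
    by case: (b) b0 => // c _; rewrite expnS leq_mul2l /= ltn_expl.
  have b1 : (0 < b ^ x)%N by rewrite expn_gt0 b0.
  by apply: leq_trans (leq_mul bx b2); nia.
by move=> H'; apply: leq_trans H'; nia.
Qed.

(** Starting inequality of [iter_expn_tower] for [b = 16 * n * W.+1] and [s = 8 * W.+1]. The left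
    side is at most cubic in [tower n], which three further exponentials absorb. *)
Lemma tower_base_bound (n W : nat) : (0 < n)%N -> (W <= tower n)%N ->
  (16 * n * W.+1 * (8 * W.+1) + 16 * n * W.+1 <= tower (n + 3))%N.
Proof.
move=> n0 Ww; have nw := ltn_tower n.
have -> : (n + 3 = n.-1.+4)%N by lia.
have wE : tower n = (2 ^ tower n.-1)%N by rewrite -towerS prednK.
rewrite wE in Ww nw; rewrite !towerS; set v := tower n.-1 in Ww nw *.
have v0 : (0 < v)%N by apply: leq_ltn_trans (ltn_tower n.-1).
have vw : (v < 2 ^ v)%N by rewrite ltn_expl.
set w := (2 ^ v)%N in Ww nw vw *.
have h1 : (16 * n * W.+1 * (8 * W.+1) + 16 * n * W.+1 <= 2 ^ 10 * w ^ 3)%N.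
  have e1 : (16 * n * W.+1 <= 32 * (w * w))%N by nia.
  have e2 : (8 * W.+1 + 1 <= 32 * w)%N by lia.
  have -> : (2 ^ 10 * w ^ 3 = 32 * (w * w) * (32 * w))%N by rewrite !expnS; lia.
  by apply: leq_trans (leq_mul e1 e2); rewrite mulnDr muln1.
apply: leq_trans h1 _; rewrite /w -expnM -expnD leq_exp2l//.
have h2 : (10 + v * 3 <= 2 ^ (v + 3))%N by rewrite expnD -/w; lia.
apply: leq_trans h2 _; rewrite leq_exp2l//.
have h3 : (v + 3 <= 2 ^ v.+1)%N by rewrite expnS -/w; lia.
by apply: leq_trans h3 _; rewrite leq_exp2l.
Qed.

Lemma log2_le (R : realType) (m : nat) (x : R) : x <= (2 ^ m)%:R -> log2 x <= m%:R.
Proof.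
have ln2_gt0 : 0 < ln 2 :> R by rewrite ln_gt0// ltr1n.
move=> xm; rewrite /log2 ler_pdivrMr//.
(* [ln] takes the default value 0 on nonpositive reals. *)
have [x0|x0] := leP x 0; first by rewrite ln0// mulr_ge0// ltW.
have -> : m%:R * ln 2 = ln (2 ^+ m) :> R by rewrite lnXn// mulr_natl.
by rewrite ler_ln ?posrE ?exprn_gt0// -natrX.
Qed.

Lemma logstar_le (R : realType) (j : nat) (x : R) :
  x <= (tower j)%:R -> (logstar x <= j)%N.
Proof.
move=> xj; rewrite /logstar; case: ex_minnP => k _; apply.
elim: j x xj => // j IH x xj; rewrite iterSr; apply: IH.
by apply: log2_le; rewrite -towerS.
Qed.

(** The coarse estimate [n <= 40 * 2 ^ n] is enough: it allows lists of length about [tower n], and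
    this height affects only the final constant. *)
Lemma truncn_log2_root_le (R : realType) (n : nat) : (0 < n)%N ->
  (Num.truncn (log2 ((n%:R : R) `^ (1 / 5) / 40)) <= n)%N.
Proof.
move=> n0; have n1 : 1 <= n%:R :> R by rewrite ler1n.
rewrite truncn_le_nat; apply: (@le_lt_trans _ _ n%:R); last by rewrite ltr_nat.
apply: log2_le; rewrite ler_pdivrMr//.
have : n%:R `^ (1 / 5) <= n%:R `^ 1 :> R by rewrite ler_powR//; lra.
rewrite powRr1// => /le_trans; apply.
by rewrite -natrM ler_nat; have := ltn_expl n (isT : 1 < 2)%N; lia.
Qed.

(** * From clusters to lists *)

Section cluster_to_list_reduction.
Local Open Scope classical_set_scope.

(** * Finite description of an output *)

Section incidence.
Context (I : finType) (d : measure_display) (Y : measurableType d).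
Variable B : I -> set Y.

(** Recording only which of finitely many events occur replaces an arbitrary output space by a
    finite one. Every property of the pattern is a measurable event, so privacy carries over. *)
Definition incidence (y : Y) : {set I} := [set i | `[< B i y >]]%SET.

Hypothesis mB : forall i, measurable (B i).

Lemma measurable_incidence1 (o : {set I}) : measurable [set y | incidence y = o].
Proof.
rewrite [X in measurable X](_ : _ = \bigcap_(i in [set: I])
    (if i \in o then B i else ~` B i)).
  apply: fin_bigcap_measurable => // i _.
  by case: ifP => _; [exact: mB | exact/measurableC/mB].
apply/seteqP; split=> [y /= <- i _|y /= yo].
  by rewrite inE; case: asboolP.
apply/setP => i; rewrite inE; have := yo i Logic.I.
by case: ifP => _ /= h; [exact/asboolP | exact/asboolP].
Qed.

Lemma measurable_incidence (T : pred {set I}) : measurable [set y | T (incidence y)].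
Proof.
rewrite [X in measurable X](_ : _ = \bigcup_(o in [set` T]) [set y | incidence y = o]).
  by apply: fin_bigcup_measurable => // o _; exact: measurable_incidence1.
by apply/seteqP; split=> [y /= Ty|y [ o /= To yo]]; [exists (incidence y)|rewrite /= yo].
Qed.

Lemma probability_incidence (R : realType) (P : probability Y R) (T : pred {set I}) :
  (P [set y | T (incidence y)] =
   (\sum_(o | T o) fine (P [set y | incidence y = o]))%:E)%E.
Proof.
rewrite -sumEFin (eq_bigr (fun o => P [set y | incidence y = o])); last first.
  by move=> o _; rewrite fineK// fin_num_measure//; exact: measurable_incidence1.
rewrite bigfs ?index_enum_uniq//; last first.
  by move=> o _; rewrite mem_index_enum.
rewrite -measure_fin_bigcup//.
- congr (P _); apply/seteqP.
  by split=> [y /= Ty|y [ o /= To yo]]; [exists (incidence y)|rewrite /= yo].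
- by move=> o o' _ _ [y [/= <- <-]].
- by move=> o _; exact: measurable_incidence1.
Qed.

End incidence.

(** * Equally spaced candidates *)

Section candidates.
Context (R : realType).

(** For [W > 0] these points cut [c - r, c + r] into [W] equal parts, from [c - r] at [j = 0] to
    [c + r] at [j = W]. *)
Definition candidate (W j : nat) (cr : R * R) : R :=
  cr.1 - cr.2 + j%:R * (2 * cr.2 / W%:R).

(** Either [c - r] already lies in [lo, hi], or the first candidate to reach [lo] does: the spacing
    is at most half of [hi - lo], so it cannot jump past [hi]. *)
Lemma candidate_between (W : nat) (c r x lo hi : R) : (0 < W)%N ->
  lo <= x <= hi -> `|x - c| <= r -> r <= W%:R / 4 * (hi - lo) ->
  exists j : 'I_W.+1, lo <= candidate W j (c, r) <= hi.
Proof.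
move=> W0 /andP[lox xhi] xcr rW; have WR : 0 < W%:R :> R by rewrite ltr0n.
move: xcr; rewrite ler_distl => /andP[cx xc].
have [lec|ltc] := leP lo (c - r).
  by exists ord0; rewrite /candidate/= mul0r addr0 lec (le_trans cx).
have candW : candidate W W (c, r) = c + r.
  rewrite /candidate/=; field; exact: lt0r_neq0.
have stepE j : candidate W j.+1 (c, r) = candidate W j (c, r) + 2 * r / W%:R.
  by rewrite /candidate/= -[j.+1]addn1 natrD; ring.
have exlo : exists j, lo <= candidate W j (c, r).
  by exists W; rewrite candW (le_trans lox).
case: (ex_minnP exlo) => j loj minj.
have jW : (j < W.+1)%N by rewrite ltnS minj// candW (le_trans lox).
exists (Ordinal jW) => /=; rewrite loj/=.
case: j jW loj minj => [_|j _ _ minj].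
  by rewrite /candidate/= mul0r addr0 leNgt ltc.
have : candidate W j (c, r) < lo.
  by rewrite ltNge; apply/negP => /minj; rewrite ltnn.
have : 2 * r / W%:R <= (hi - lo) / 2.
  by rewrite ler_pdivrMr//; lra.
by rewrite stepE; lra.
Qed.

Lemma measurable_candidate (W j : nat) (v : R) :
  measurable [set cr : measurableTypeR R * measurableTypeR R |
    v < candidate W j cr].
Proof.
have m : measurable_fun setT (fun cr : measurableTypeR R * measurableTypeR R =>
    v < candidate W j cr).
  apply: measurable_fun_ltr => //; apply: measurable_funD.
    by apply: measurable_funB; [exact: measurable_fst|exact: measurable_snd].
  apply: measurable_funM => //; apply: measurable_funM => //.
  by apply: measurable_funM => //; exact: measurable_snd.
have := m measurableT [set true] Logic.I; rewrite setTI.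
by congr measurable; apply/seteqP; split.
Qed.

Lemma measurable_in_ball (x : R) :
  measurable [set cr : measurableTypeR R * measurableTypeR R |
    `|x - cr.1| <= cr.2].
Proof.
have m : measurable_fun setT (fun cr : measurableTypeR R * measurableTypeR R =>
    `|x - cr.1| <= cr.2).
  apply: measurable_fun_ler; last exact: measurable_snd.
  apply: measurableT_comp => //.
  by apply: measurable_funB => //; exact: measurable_fst.
have := m measurableT [set true] Logic.I; rewrite setTI.
by congr measurable; apply/seteqP; split.
Qed.

End candidates.

(** * From clusters to ranks *)

Section cluster_to_list.
Context (R : realType) (X : {fset R}).

(** Monotone on the reals and, on [X], the order isomorphism onto an initial segment of the
    integers. A real between two points of [X] thus has its rank between theirs. *)
Definition rank (y : R) : nat := #|[pred v : X | val v < y]|.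

Lemma rank_le (y z : R) : y <= z -> (rank y <= rank z)%N.
Proof.
move=> yz; apply: subset_leq_card; apply/fintype.subsetP => v; rewrite !inE => vy.
exact: lt_le_trans vy yz.
Qed.

Lemma rank_lt (v : X) (z : R) : val v < z -> (rank (val v) < rank z)%N.
Proof.
move=> vz; apply: proper_card; apply/fintype.properP; split.
  by apply/fintype.subsetP => u; rewrite !inE => /lt_trans; apply.
by exists v; rewrite !inE ?ltxx.
Qed.

Lemma rank_onto (i : nat) : (i < #|` X|)%N -> exists v : X, rank (val v) = i.
Proof.
rewrite cardfE => iX.
have rX (v : X) : (rank (val v) < #|{: X}|)%N.
  apply: proper_card; apply/fintype.properP; split; first exact/fintype.subsetP.
  by exists v; rewrite // !inE ltxx.
pose f (v : X) : 'I_#|{: X}| := Ordinal (rX v).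
have /inj_card_bij[|g gK fK] : injective f.
- move=> u v [uv]; apply: val_inj; apply/eqP; rewrite eq_le !leNgt.
  by apply/andP; split; apply/negP => /rank_lt; rewrite uv ltnn.
- by rewrite card_ord.
by exists (g (Ordinal iX)); have [] := fK (Ordinal iX).
Qed.

(** [ball_count] is the number of ball events, one for each row, that occur; the condition on it
    depends only on their incidence pattern. *)
Lemma measurable_solution (n : nat) (S : n.-tuple X) (a q : R) :
  measurable [set cr : measurableTypeR R * measurableTypeR R |
    a <= (ball_count S cr.1 cr.2)%:R /\ cr.2 <= q].
Proof.
pose B (i : 'I_n) := [set cr : measurableTypeR R * measurableTypeR R |
  `|val (tnth S i) - cr.1| <= cr.2].
have mB i : measurable (B i) by exact: measurable_in_ball.
rewrite [X in measurable X](_ : _ = [set cr | a <= #|incidence B cr|%:R] `&`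
    [set cr : measurableTypeR R * measurableTypeR R | cr.2 <= q]).
  apply: measurableI; first exact: (measurable_incidence mB (fun o => a <= #|o|%:R)).
  have m : measurable_fun setT (fun cr : measurableTypeR R * measurableTypeR R =>
      cr.2 <= q).
    by apply: measurable_fun_ler => //; exact: measurable_snd.
  have := m measurableT [set true] Logic.I; rewrite setTI.
  by congr measurable; apply/seteqP; split.
apply/seteqP; split=> cr /=; rewrite /ball_count;
  (have -> : #|incidence B cr| = #|[pred i : 'I_n | `|val (tnth S i) - cr.1| <= cr.2]|;
    last by []);
  by apply: eq_card => i; rewrite !inE; apply/asboolP/idP.
Qed.

Lemma r_opt_bounds (n t : nat) (S : n.-tuple X) (c : X) (r : R) : (t <= n)%N ->
  0 <= r -> (forall i, `|val (tnth S i) - val c| <= r) -> 0 <= r_opt t S <= r.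
Proof.
move=> tn r0 Sr; pose A := [set r' : R | 0 <= r' /\
  exists c : X, (t <= ball_count S (val c) r')%N].
have Ar : A r.
  split=> //; exists c; apply: leq_trans tn _; rewrite -[X in (X <= _)%N]card_ord.
  by apply: subset_leq_card; apply/fintype.subsetP => i _; rewrite inE Sr.
have A0 : lbound A 0 by move=> ? [].
rewrite /r_opt -/A; apply/andP; split.
  by apply: lb_le_inf => //; exists r.
by apply: ge_inf => //; exists 0.
Qed.

Variables (n t s W : nat) (Delta w eps delta beta : R).
Variable M : n.-tuple X -> probability (measurableTypeR R * measurableTypeR R)%type R.
Hypothesis n0 : (0 < n)%N.
Hypothesis s0 : (0 < s)%N.
Hypothesis sX : (s <= #|` X|)%N.
Hypothesis W0 : (0 < W)%N.
Hypothesis Deltat : Delta < t%:R.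
Hypothesis tn : (t <= n)%N.
Hypothesis wW : w <= W%:R / 4.
Hypothesis M_dp : differentially_private eps delta M.
Hypothesis M_solves : solves_1cluster t Delta w beta M.

(** These events tell which points of [X] lie below each candidate, so [f] can read the ranks of all
    candidates off the pattern. *)
Let B (jv : 'I_W.+1 * X) : set (measurableTypeR R * measurableTypeR R) :=
  [set cr | val jv.2 < candidate W jv.1 cr].

Let f (o : {set 'I_W.+1 * X}) : seq nat :=
  [seq #|[pred v : X | (j, v) \in o]| | j : 'I_W.+1].

Let mB jv : measurable (B jv).
Proof. exact: measurable_candidate. Qed.

Let mem_rank (j : 'I_W.+1) (cr : R * R) : rank (candidate W j cr) \in f (incidence B cr).
Proof.
have -> : rank (candidate W j cr) = #|[pred v : X | (j, v) \in incidence B cr]|.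
  by apply: eq_card => v; rewrite !inE; apply/idP/asboolP.
exact: fintype.image_f.
Qed.

Lemma list_ipp_of_1cluster : list_ipp (expR eps) delta (1 - beta) W.+1 n s.
Proof.
(* [e] lists the [s] lowest points of [X] in increasing order; its values from [s] on are
   arbitrary. *)
have [e eP] : exists e : nat -> X, forall i, (i < s)%N -> rank (val (e i)) = i.
  have [v0 _] := rank_onto (leq_trans s0 sX).
  have /choice[e eP] : forall i, exists v : X, (i < s)%N -> rank (val v) = i.
    move=> i; have [si|/leq_trans/(_ sX) iX] := leqP s i.
      by exists v0.
    by have [v] := rank_onto iX; exists v.
  by exists e.
have e_le i j : (i < s)%N -> (j < s)%N -> (i <= j)%N -> val (e i) <= val (e j).
  move=> si sj; apply: contraTT; rewrite -!ltNge -ltnNge => /rank_lt.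
  by rewrite !eP.
pose db (x : seq nat) : n.-tuple X := [tuple e (nth 0%N x i) | i < n].
pose p x o := fine (M (db x) [set cr | incidence B cr = o]).
have pE x (T : pred {set 'I_W.+1 * X}) :
    M (db x) [set cr | T (incidence B cr)] = (\sum_(o | T o) p x o)%:E.
  exact: probability_incidence.
exists {set 'I_W.+1 * X}, p, f; split.
- by move=> x o _; exact: fine_ge0.
- move=> x _; apply: EFin_inj; rewrite -(pE x predT) -(probability_setT (M (db x))).
  by congr (M _ _); apply/seteqP; split.
- by move=> o; rewrite size_image card_ord.
- move=> x1 x2 u v ru rv T; rewrite -lee_fin EFinD EFinM -!pE; apply: M_dp.
    apply/card_le1_eqP => i j; rewrite !inE !tnth_mktuple.
    have diff (l : 'I_n) :
        e (nth 0%N (x1 ++ u :: x2) l) != e (nth 0%N (x1 ++ v :: x2) l) ->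
        val l = size x1.
      apply: contraNeq => /eqP l_neq; apply/eqP; congr e.
      rewrite !nth_cat; case: ltnP => // le_l.
      by case: (l - size x1)%N (subnKC le_l) => [|//]; rewrite addn0 => /esym.
    by move=> /diff ix /diff jx; apply: val_inj; rewrite ix jx.
  exact: (measurable_incidence mB).
- move=> x /andP[/eqP sx /allP xs].
  rewrite -lee_fin -pE; apply: le_trans (M_solves (db x)) _.
  apply: le_measure; rewrite ?inE.
  + exact: measurable_solution.
  + exact: (measurable_incidence mB (fun o => hits x (f o))).
  move=> [c r] /= [cnt rw].
  have x0 : x != [::] by rewrite -size_eq0 sx -lt0n.
  have [mu mux /allP mule] := seq_min x0.
  have mx := seq_max x0; set m := (\max_(i <- x) i)%N in mx.
  have lem i : i \in x -> (i <= m)%N by move=> ix; exact: (@leq_bigmax_seq _ x predT id).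
  have dbP (i : 'I_n) : exists2 k, k \in x & tnth (db x) i = e k.
    by exists (nth 0%N x i); rewrite ?mem_nth ?sx// tnth_mktuple.
  have db_bounds i : val (e mu) <= val (tnth (db x) i) <= val (e m).
    have [k kx ->] := dbP i.
    by rewrite !e_le ?xs ?mule ?lem.
  (* The count is at least [t - Delta > 0], so the ball contains a row. *)
  have [i ixr] : exists i : 'I_n, `|val (tnth (db x) i) - c| <= r.
    case: (pickP (fun i : 'I_n => `|val (tnth (db x) i) - c| <= r)) => [i|none].
      by exists i.
    by move: cnt; rewrite /ball_count eq_card0//=; move: Deltat; lra.
  (* The ball around the smallest row with radius max - min contains all [n >= t] rows. *)
  have /andP[ro0 ror] : 0 <= r_opt t (db x) <= val (e m) - val (e mu).
    apply: (r_opt_bounds (c := e mu)) => //.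
      by rewrite subr_ge0 e_le ?xs// lem.
    move=> k; have /andP[h1 h2] := db_bounds k.
    by rewrite ger0_norm ?subr_ge0// lerB.
  have rle : r <= W%:R / 4 * (val (e m) - val (e mu)).
    apply: le_trans rw _; apply: le_trans (ler_wpM2r ro0 wW) _.
    by rewrite ler_wpM2l// divr_ge0.
  have [j /andP[loj jhi]] := candidate_between W0 (db_bounds i) ixr rle.
  apply/hasP; exists (rank (candidate W j (c, r))); first exact: mem_rank.
  apply/andP; split; apply/hasP.
    by exists mu => //; rewrite -[mu]eP ?xs// rank_le.
  by exists m => //; rewrite -[m]eP ?xs// rank_le.
Qed.

End cluster_to_list.

End cluster_to_list_reduction.

(** * Choice of parameters and conclusion *)

Lemma differentially_private_le (R : realType) (eps delta delta' : R)
    (U : eqType) (n : nat) (d : measure_display) (Y : measurableType d)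
    (M : n.-tuple U -> probability Y R) : delta <= delta' ->
  differentially_private eps delta M -> differentially_private eps delta' M.
Proof.
move=> dd' Mdp S S' SS' T mT; apply: le_trans (Mdp S S' SS' T mT) _.
by rewrite leeD2l// lee_fin.
Qed.

(** If [n = 0] then [t = 0] and [Delta < 0]: an empty database would have to reach a positive count,
    so the success event is empty. *)
Lemma solves_1cluster_gt0 (R : realType) (X : {fset R}) (n t : nat)
    (Delta w beta : R)
    (M : n.-tuple X ->
         probability (measurableTypeR R * measurableTypeR R)%type R) :
  Delta < t%:R -> (t <= n)%N -> beta < 1 -> solves_1cluster t Delta w beta M ->
  (0 < n)%N.
Proof.
case: n M => // M Dt; rewrite leqn0 => /eqP t0 beta1 /(_ [tuple]).
rewrite [X in (_ <= _ X)%E](_ : _ = set0); last first.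
  apply/seteqP; split=> // cr [+ _]; rewrite /ball_count eq_card0 => [|[]//].
  by move: Dt; rewrite t0; lra.
by rewrite measure0 lee_fin; lra.
Qed.

Lemma cluster_domain_bound (R : realType) (eps beta delta w Delta : R)
    (X : {fset R}) (n t W : nat)
    (M : n.-tuple X ->
         probability (measurableTypeR R * measurableTypeR R)%type R) :
  0 < eps < 1 / 8 -> 0 < beta < 1 / 8 -> (0 < n)%N ->
  delta <= 1 / (200 * n%:R ^+ 2) -> Delta < t%:R -> (t <= n)%N ->
  (0 < W)%N -> w <= W%:R / 4 ->
  differentially_private eps delta M -> solves_1cluster t Delta w beta M ->
  (#|` X| <= iter n.-1 (expn (16 * n * W.+1)) (8 * W.+1))%N.
Proof.
move=> /andP[eps0 eps1] /andP[beta0 beta1] n0 hdelta Dt tn W0 wW Mdp Msol.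
(* With lists of [L = W + 1] points, the last step costs [e / 8] and all digit guesses together at
   most [e / 16]. With [e <= 2] and the [delta] terms, the total stays below 7/8, whereas
   [1 - beta > 7 / 8]. *)
set b := (16 * n * W.+1)%N; set s := (8 * W.+1)%N; rewrite leqNgt; apply/negP => ltX.
have b0 : (0 < b)%N by rewrite !muln_gt0 n0.
have s0 : (0 < s)%N by [].
have it0 : (0 < iter n.-1 (expn b) s)%N by case: n.-1 => //= k; rewrite expn_gt0 b0.
have := list_ipp_of_1cluster n0 it0 (ltnW ltX) W0 Dt tn wW
  (differentially_private_le hdelta Mdp) Msol.
set d := 1 / _ => ipp.
have e0 := expR_ge0 eps; set e := expR eps in ipp e0 *.
have e2 : e <= 2.
  (* Combined with [expR (- eps) >= 1 - eps > 7 / 8]. *)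
  have : e * expR (- eps) = 1 by rewrite -expRD subrr expR0.
  have := expR_ge1Dx (- eps); nra.
have := ipp; rewrite -[X in list_ipp _ _ _ _ X _](prednK n0).
move=> /(list_ipp_iter e0 b0 s0).
have nR : 1 <= n%:R :> R by rewrite ler1n.
have WR : W.+1%:R != 0 :> R by rewrite pnatr_eq0.
have n_neq0 : n%:R != 0 :> R by rewrite pnatr_eq0 -lt0n.
have -> : e * W.+1%:R / s%:R = e / 8 by rewrite natrM; field.
have -> : e * W.+1%:R / b%:R = e / 16 / n%:R.
  by rewrite !natrM; move: (W.+1%:R : R) WR => L L0; field; rewrite n_neq0 L0.
have d0 : 0 <= d by rewrite divr_ge0// mulr_ge0// exprn_ge0.
have nd : n%:R * d <= 1 / 200.
  have -> : n%:R * d = n%:R^-1 / 200 by rewrite /d; field.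
  by rewrite ler_pM2r ?invr_gt0// invf_le1 ?ltr0n.
have nL : n%:R * (e / 16 / n%:R) = e / 16 by field.
have : (n.-1)%:R * (e / 16 / n%:R + d) <= n%:R * (e / 16 / n%:R + d).
  by rewrite ler_wpM2r ?ler_nat ?leq_pred// addr_ge0// !divr_ge0.
rewrite [leRHS]mulrDr nL.
have : d <= n%:R * d by rewrite ler_peMl.
lra.
Qed.

Theorem corollary5p4 (R : realType) (eps beta : R)
    (heps : 0 < eps < 1 / 8) (hbeta : 0 < beta < 1 / 8) :
  exists2 C : R, 0 < C &
  forall (delta : nat -> R)
    (hdelta : forall n : nat, (0 < n)%N -> delta n <= 1 / (200 * n%:R ^+ 2))
    (X : {fset R}) (n t : nat) (Delta w : R)
    (hDelta : Delta < t%:R) (htn : (t <= n)%N)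
    (hw : w <= 1 / 4 * (tower (Num.truncn (log2 ((n%:R : R) `^ (1 / 5) / 40))))%:R)
    (M : n.-tuple X ->
         probability (measurableTypeR R * measurableTypeR R)%type R),
  differentially_private eps (delta n) M ->
  solves_1cluster t Delta w beta M ->
  C * (logstar (#|` X|%:R : R))%:R <= n%:R.
Proof.
(* The tower reached below has height [(n - 1) + (n + 3) = 2 * n + 2], at most [5 * n] since
   [n >= 1]. *)
exists (1 / 5); first by [].
move=> delta hdelta X n t Delta w hDelta htn hw M Mdp Msol.
have n0 : (0 < n)%N.
  by apply: solves_1cluster_gt0 hDelta htn _ Msol; move: hbeta => /andP[_]; lra.
set W := tower _ in hw.
have W0 : (0 < W)%N by apply: leq_ltn_trans (ltn_tower _).
have wW : w <= W%:R / 4 by lra.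
have XN := cluster_domain_bound heps hbeta n0 (hdelta n n0) hDelta htn W0 wW Mdp Msol.
have b0 : (0 < 16 * n * W.+1)%N by rewrite !muln_gt0 n0.
have Wn : (W <= tower n)%N by apply/leq_tower/truncn_log2_root_le.
have XT := leq_trans XN (iter_expn_tower n.-1 b0 (tower_base_bound n0 Wn)).
have : (logstar (#|` X|%:R : R) <= 5 * n)%N.
  by apply: leq_trans (logstar_le _) _; [rewrite ler_nat; exact: XT|lia].
by rewrite -(ler_nat R) natrM; lra.
Qed.
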